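(* Let $K\ge2$ and let $\mu,\mu'\in\mathcal G^*$ have the same unique optimal arm $a^*$. Write $\Delta_a=\mu_{a^*}-\mu_a$, $\Delta'_a=\mu'_{a^*}-\mu'_a$, $w=w(\mu)$, $w'=w(\mu')$, $T=T(\mu)$, $T'=T(\mu')$. Assume that for some $\varepsilon\in[0,1/7]$, $$(1-\varepsilon)\Delta_a^2\le{\Delta'_a}^2\le(1+\varepsilon)\Delta_a^2\qquad\text{for all }a\ne a^*.$$ Then $$(1-3\varepsilon)T\le T'\le(1+6\varepsilon)T$$ and $$(1-10\varepsilon)w_a\le w'_a\le(1+10\varepsilon)w_a\qquad\text{for all }a\in\{1,\dots,K\}.$$
   Context: $\mathcal G^*$ is the set of vectors $\mu\in[0,1]^K$ whose maximal coordinate is attained at a unique index $a^*(\mu)$ (the optimal arm). $\Sigma_K=\{v\in[0,1]^K:\sum_av_a=1\}$. For $\mu\in\mathcal G^*$ with $a^*=a^*(\mu)$, the characteristic time $T(\mu)$ is defined by $$T(\mu)^{-1}=\sup_{v\in\Sigma_K}\inf_{\lambda\in\mathcal G^*:\,a^*(\lambda)\ne a^*}\sum_{a=1}^Kv_a\frac{(\mu_a-\lambda_a)^2}{2}=\sup_{v\in\Sigma_K}\frac12\min_{a\ne a^*}\frac{v_{a^*}v_a}{v_{a^*}+v_a}(\mu_{a^*}-\mu_a)^2,$$ and the optimal weight vector $w(\mu)\in\Sigma_K$ is the unique maximizer $v$. *)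

(* Defs.v *)
From mathcomp Require Import all_boot all_order all_algebra.
From mathcomp Require Import all_classical all_reals.

Set Implicit Arguments.
Unset Strict Implicit.
Unset Printing Implicit Defensive.
Import Order.TTheory GRing.Theory Num.Theory.

Local Open Scope classical_set_scope.
Local Open Scope ring_scope.

Section BestArmIdentification.
Context {R : realType} {K : nat}.
Implicit Types (mu lambda v : 'rV[R]_K) (a : 'I_K).

Definition Gstar : set 'rV[R]_K :=
  [set mu | (forall a, 0 <= mu 0 a <= 1) /\
            exists! a, forall b, mu 0 b <= mu 0 a].

(* On Gstar this is [Some a] with [a] the unique optimal arm; the option only
   avoids choosing a default element of ['I_K]. *)
Definition best_arm mu : option 'I_K :=
  [pick a | [forall b, mu 0 b <= mu 0 a]].

Definition simplex : set 'rV[R]_K :=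
  [set v | (forall a, 0 <= v 0 a <= 1) /\ \sum_a v 0 a = 1].

Definition Alt mu : set 'rV[R]_K :=
  [set lambda | Gstar lambda /\ best_arm lambda <> best_arm mu].

Definition transport_cost mu v lambda : R :=
  \sum_a v 0 a * ((mu 0 a - lambda 0 a) ^+ 2 / 2).

(* [inf] and [sup] are the real-valued ones. When [2 <= K], [mu] is in Gstar
   and [v] in the simplex, the sets below are nonempty and bounded, so these
   are the genuine infimum and supremum. *)
Definition inf_cost mu v : R := inf (transport_cost mu v @` Alt mu).

Definition char_time mu : R := (sup (inf_cost mu @` simplex))^-1.

Definition optimal_weights mu : set 'rV[R]_K :=
  [set v | simplex v /\ forall u, simplex u -> inf_cost mu u <= inf_cost mu v].

(* For [2 <= K] and [mu] in Gstar, [optimal_weights mu] is a singleton and this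
   is its element; the default value 0 is irrelevant. *)
Definition opt_weight mu : 'rV[R]_K := xget 0 (optimal_weights mu).

End BestArmIdentification.

(* Main.v *)
(* Let s be the optimal arm and D_a = (mu_s - mu_a)^2. Minimising the transport
   cost over the alternatives gives min_a w_s w_a / (w_s + w_a) D_a / 2. Let y
   be the solution of sum_(a != s) (y / (D_a - y))^2 = 1 with 0 < 2 y <= D_a.
   The optimal weights satisfy w_s y = w_a (D_a - y) = c for all a != s, and
   T = 2 / c: optimality and uniqueness follow from
     u v / (u + v) (x + z)^2 = u x^2 + v z^2 - (u x - v z)^2 / (u + v)
   with u = w_s, v = w_a, x = y and z = D_a - y, divided by (D_a - y)^2 and
   summed over a. Both c and y are monotone and 1-homogeneous in D, so they
   change by factors in [1 - eps, 1 + eps]; as 2 y <= D_a, subtracting y from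
   D_a loses little relative precision, which controls the weights c / y and
   c / (D_a - y). *)
Require Import Defs.
From mathcomp Require Import all_boot all_order all_algebra.
From mathcomp Require Import all_classical all_reals.
From mathcomp Require Import topology normedtype realfun.
From mathcomp Require Import ring lra.
Import Order.TTheory GRing.Theory Num.Theory.
Import numFieldNormedType.Exports.
Local Open Scope classical_set_scope.
Local Open Scope ring_scope.

(** * Two weighted squares, and the equation that defines [y] *)

(* For [s = t = 0] both quotients are the junk value 0 and the identity still
   holds. *)
Lemma weighted_squares_split (R : realFieldType) (s t x z : R) :
  0 <= s -> 0 <= t ->
  s * x ^+ 2 + t * z ^+ 2
    = s * t / (s + t) * (x + z) ^+ 2 + (s * x - t * z) ^+ 2 / (s + t).
Proof.
move=> s0 t0; have [st0|st0] := eqVneq (s + t) 0; last by field.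
have -> : s = 0 by lra.
have -> : t = 0 by lra.
by rewrite !mul0r subr0 expr0n mul0r addr0.
Qed.

Lemma weighted_squares_ge (R : realFieldType) (s t x z : R) :
  0 <= s -> 0 <= t ->
  s * t / (s + t) * (x + z) ^+ 2 <= s * x ^+ 2 + t * z ^+ 2.
Proof.
move=> s0 t0; rewrite weighted_squares_split// lerDl.
by rewrite divr_ge0 ?sqr_ge0 ?addr_ge0.
Qed.

(** With [z = D a - y], this shows that the weights [c / y] and [c / z] make all arms other than the
    optimal one equally costly. *)
Lemma equalized_weights_cost (R : realFieldType) (c y z : R) :
  0 < c -> 0 < y -> 0 < z ->
  (c / y) * (c / z) / (c / y + c / z) * (y + z) = c.
Proof.
move=> c0 y0 z0; have -> : c / y + c / z = c * (y + z) / (y * z).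
  by field; rewrite !gt_eqF.
by field; rewrite !gt_eqF ?addr_gt0.
Qed.

(** Intermediate value theorem on [[0, D m / 2]], where [D m] is the least value: the sum vanishes
    at 0, and at [D m / 2] the term of [m] alone is already 1. *)
Lemma exists_unit_square_sum (R : realType) (I : finType) (P : pred I)
    (D : I -> R) :
  (exists i, P i) -> (forall i, P i -> 0 < D i) ->
  exists y, [/\ 0 < y, forall i, P i -> 2 * y <= D i &
    \sum_(i | P i) (y / (D i - y)) ^+ 2 = 1].
Proof.
move=> [i0 Pi0] D_gt0.
case: (arg_minP D Pi0) => m Pm D_ge.
have Dm0 := D_gt0 _ Pm.
pose h y := \sum_(i | P i) (y / (D i - y)) ^+ 2.
have le0 : 0 <= D m / 2 by lra.
have h0 : h 0 = 0 by rewrite /h big1// => i _; rewrite mul0r expr0n.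
have hm : 1 <= h (D m / 2).
  rewrite /h (bigD1 m)//= -[leLHS]addr0 lerD//.
    by rewrite (_ : D m - D m / 2 = D m / 2) ?divff ?expr1n//; lra.
  by apply: sumr_ge0 => i _; exact: sqr_ge0.
have hc : {within `[0, D m / 2], continuous h}.
  apply: continuous_in_subspaceT => y; rewrite inE/= in_itv/= => /andP[y0 yD].
  apply: cvg_big => [|i Pi]; first exact: add_continuous.
  have Dy : D i - y != 0 by have := D_ge i Pi; lra.
  apply: (cvg_comp (fun z => z / (D i - z)) (fun z => z ^+ 2));
    last exact: exprn_continuous.
  apply: cvgM; first exact: cvg_id.
  by apply: cvgV => //; apply: cvgB; [exact: cvg_cst|exact: cvg_id].
have [|y] := IVT le0 hc (v := 1).
  by rewrite h0 min_l ?max_r ?hm ?ler01//; exact: le_trans ler01 hm.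
rewrite in_itv/= => /andP[y0 yD] hy; exists y; split => //.
- rewrite lt_neqAle y0 andbT; apply/eqP => y00.
  by move: hy; rewrite -y00 h0 => /eqP; rewrite eq_sym oner_eq0.
- by move=> i /D_ge; lra.
Qed.

(** * The infimum cost as a minimum over single competing arms *)

Section InfCost.
Context {R : realType} {K : nat}.
Implicit Types (mu lambda v : 'rV[R]_K) (a b s : 'I_K).

Lemma best_arm_lt mu s a :
  Gstar mu -> best_arm mu = Some s -> a != s -> mu 0 a < mu 0 s.
Proof.
rewrite /best_arm => -[_ [c [_ cuniq]]]; case: pickP => //.
move=> d /forallP dmax [ds] as_.
rewrite {d}ds in dmax; rewrite lt_neqAle dmax andbT.
apply: contra as_ => /eqP mas; rewrite -(cuniq s dmax) -(cuniq a)// => b.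
by rewrite mas; exact: dmax.
Qed.

Lemma best_arm_strict mu b :
  (forall a, 0 <= mu 0 a <= 1) -> (forall a, a != b -> mu 0 a < mu 0 b) ->
  Gstar mu /\ best_arm mu = Some b.
Proof.
move=> mu01 mub.
have uniqb c : (forall a, mu 0 a <= mu 0 c) -> c = b.
  move=> cmax; apply/eqP/negPn/negP => /mub; apply/negP.
  by rewrite -leNgt.
have bmax a : mu 0 a <= mu 0 b.
  by have [->//|/mub/ltW] := eqVneq a b.
split; first by split=> //; exists b; split => // c /uniqb.
rewrite /best_arm; case: pickP => [c /forallP/uniqb -> //|/(_ b)].
by move/forallP: bmax => ->.
Qed.

Lemma transport_cost_ge0 mu v lambda :
  simplex v -> 0 <= transport_cost mu v lambda.
Proof.
move=> [v01 _]; apply: sumr_ge0 => a _; have /andP[va _] := v01 a.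
by rewrite mulr_ge0// divr_ge0 ?sqr_ge0.
Qed.

Lemma inf_cost_le_transport mu v lambda :
  simplex v -> Alt mu lambda -> inf_cost mu v <= transport_cost mu v lambda.
Proof.
move=> sv al; apply: ge_inf; last by exists lambda.
by exists 0 => _ [l _ <-]; exact: transport_cost_ge0.
Qed.

(* The maximum of [lambda] need not be unique; mixing [lambda] with the vertex
   of a maximal arm makes it so, at an arbitrarily small cost. *)
Lemma inf_cost_le_weak mu v lambda s b : simplex v ->
  best_arm mu = Some s -> b != s ->
  (forall a, 0 <= lambda 0 a <= 1) -> (forall a, lambda 0 a <= lambda 0 b) ->
  inf_cost mu v <= transport_cost mu v lambda.
Proof.
move=> sv mus bs l01 lb; apply/ler_addgt0Pr => e e0.
pose eb : 'rV[R]_K := \row_a (a == b)%:R.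
pose M := transport_cost mu v eb.
have M0 : 0 <= M by exact: transport_cost_ge0.
(* This choice gives both [d < 1] and [d * M <= e], whatever the size of [e]. *)
pose d := e / (M + 1 + e).
have d0 : 0 < d by rewrite divr_gt0//; lra.
have d1 : d < 1 by rewrite ltr_pdivrMr; lra.
have dM : d * M <= e.
  by rewrite /d mulrAC ler_pdivrMr; [rewrite ler_pM2l//; lra|lra].
pose l : 'rV[R]_K := \row_a ((1 - d) * lambda 0 a + d * eb 0 a).
have [|a ab|Gl lb'] := @best_arm_strict l b.
- move=> a; rewrite !mxE; have := l01 a; case: (a == b) => /=; nra.
- rewrite !mxE eqxx (negbTE ab)/= mulr0 addr0 mulr1.
  by have := lb a; nra.
have Al : Alt mu l.
  by split => //; rewrite lb' mus => -[bs']; rewrite bs' eqxx in bs.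
apply: le_trans (inf_cost_le_transport _ _ _ sv Al) _.
apply: (@le_trans _ _ ((1 - d) * transport_cost mu v lambda + d * M));
  last first.
  by have := transport_cost_ge0 mu v lambda sv; nra.
(* Arm by arm, the bound is convexity of the square. *)
rewrite /M /transport_cost !mulr_sumr -big_split/= ler_sum// => a _.
have /andP[va _] := sv.1 a.
rewrite [l _ _]mxE; move: (lambda 0 a) (eb 0 a) => x z.
have -> : (1 - d) * (v 0 a * ((mu 0 a - x) ^+ 2 / 2))
    + d * (v 0 a * ((mu 0 a - z) ^+ 2 / 2))
  = v 0 a * (((1 - d) * (mu 0 a - x) ^+ 2 + d * (mu 0 a - z) ^+ 2) / 2) by ring.
rewrite ler_wpM2l// ler_pM2r ?invr_gt0//.
rewrite -subr_ge0.
have -> : (1 - d) * (mu 0 a - x) ^+ 2 + d * (mu 0 a - z) ^+ 2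
  - (mu 0 a - ((1 - d) * x + d * z)) ^+ 2 = d * (1 - d) * (x - z) ^+ 2 by ring.
by rewrite mulr_ge0 ?sqr_ge0// mulr_ge0 ?subr_ge0 ?(ltW d0) ?(ltW d1).
Qed.

(** The cheapest way to let [a] catch up with [s] moves both to their weighted mean [m] and leaves
    the other arms alone. *)
Lemma inf_cost_le mu v s a : simplex v -> Gstar mu ->
  best_arm mu = Some s -> a != s ->
  inf_cost mu v <= v 0 s * v 0 a / (v 0 s + v 0 a) * (mu 0 s - mu 0 a) ^+ 2 / 2.
Proof.
move=> sv Gmu mus as_.
have /andP[vs0 _] := sv.1 s; have /andP[va0 _] := sv.1 a.
have sa : s == a = false by rewrite eq_sym; exact/negbTE.
have [m [m01 mE]] : exists m, 0 <= m <= 1 /\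
    v 0 s * ((mu 0 s - m) ^+ 2 / 2) + v 0 a * ((mu 0 a - m) ^+ 2 / 2)
    = v 0 s * v 0 a / (v 0 s + v 0 a) * (mu 0 s - mu 0 a) ^+ 2 / 2.
  have ms := Gmu.1 s; have ma := Gmu.1 a.
  have [st0|st0] := eqVneq (v 0 s + v 0 a) 0.
    (* With both weights zero the mean is undefined, but both sides vanish for any [m]. *)
    exists 0; split; first by rewrite lexx ler01.
    have -> : v 0 s = 0 by lra.
    have -> : v 0 a = 0 by lra.
    by rewrite !mul0r addr0.
  have stp : 0 < v 0 s + v 0 a by rewrite lt_neqAle eq_sym st0 addr_ge0.
  exists ((v 0 s * mu 0 s + v 0 a * mu 0 a) / (v 0 s + v 0 a)); split.
    by rewrite ler_pdivlMr// ler_pdivrMr//; nra.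
  by field.
pose l : 'rV[R]_K := \row_c if (c == s) || (c == a) then m else mu 0 c.
have ls : l 0 s = m by rewrite mxE eqxx.
have la : l 0 a = m by rewrite mxE eqxx orbT.
(* The best arm [b] other than [s] may differ from [a]; as [l] ties [s] with [a], it is maximal
   among all arms. *)
case: (arg_maxP (l 0) (as_ : [pred c | c != s] a)) => b bs bmax.
rewrite -mE; apply: (le_trans (inf_cost_le_weak mu v l s b sv mus bs _ _)).
- by move=> c; rewrite mxE; case: ifP => // _; exact: Gmu.1.
- move=> c; have [->|/bmax//] := eqVneq c s.
  by rewrite ls -la; exact: bmax.
rewrite /transport_cost (bigD1 s)//= (bigD1 a)//= ls la big1 ?addr0//.
move=> c /andP[cs ca]; rewrite mxE (negbTE cs) (negbTE ca)/=.
by rewrite subrr expr0n mul0r mulr0.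
Qed.

(** In an alternative [l] some arm [b] does at least as well as [s]. Only the costs of these two
    arms are kept, and [weighted_squares_ge] applies to [mu 0 s - l 0 s] and [l 0 b - mu 0 b], whose
    sum is at least the gap. *)
Lemma inf_cost_ge mu v s e : simplex v -> Gstar mu ->
  best_arm mu = Some s -> (exists a, a != s) ->
  (forall a, a != s ->
     e <= v 0 s * v 0 a / (v 0 s + v 0 a) * (mu 0 s - mu 0 a) ^+ 2 / 2) ->
  e <= inf_cost mu v.
Proof.
move=> sv Gmu mus [a0 a0s] He; apply: lb_le_inf.
  (* The vertex of [a0] shows that [Alt mu] is nonempty, so that the infimum is genuine. *)
  pose l : 'rV[R]_K := \row_a (a == a0)%:R.
  have [|a aa0|Gl la0] := @best_arm_strict l a0.
  - by move=> a; rewrite mxE; case: (a == a0) => /=; rewrite ?lexx ?ler01.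
  - by rewrite !mxE eqxx (negbTE aa0) ltr01.
  exists (transport_cost mu v l); exists l => //.
  by split => //; rewrite la0 mus => -[a0E]; rewrite a0E eqxx in a0s.
move=> _ [l [Gl lmu] <-].
have [b [bs lb]] : exists b, b != s /\ l 0 s <= l 0 b.
  have [_ [b [bmax _]]] := Gl; exists b; split; last exact: bmax.
  apply/eqP => bs; apply: lmu; rewrite mus.
  rewrite /best_arm; case: pickP => [c /forallP cmax|/(_ b)]; last first.
    by move/forallP: bmax => ->.
  by have [_ [d [_ du]]] := Gl; rewrite -(du c cmax) (du b bmax) bs.
apply: le_trans (He b bs) _.
have /andP[vs0 _] := sv.1 s; have /andP[vb0 _] := sv.1 b.
have mb := best_arm_lt mu s b Gmu mus bs.
rewrite /transport_cost (bigD1 s)//= (bigD1 b)//= addrA ler_wpDr//.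
  apply: sumr_ge0 => c _; have /andP[vc _] := sv.1 c.
  by rewrite mulr_ge0// divr_ge0 ?sqr_ge0.
have -> : v 0 s * ((mu 0 s - l 0 s) ^+ 2 / 2)
      + v 0 b * ((mu 0 b - l 0 b) ^+ 2 / 2)
    = (v 0 s * (mu 0 s - l 0 s) ^+ 2 + v 0 b * (l 0 b - mu 0 b) ^+ 2) / 2.
  by ring.
rewrite ler_pM2r ?invr_gt0//.
apply: le_trans (weighted_squares_ge _ _ _ _ _ vs0 vb0).
rewrite ler_wpM2l ?divr_ge0 ?mulr_ge0 ?addr_ge0//.
by clear lmu; rewrite ler_pXn2r ?nnegrE//; lra.
Qed.

End InfCost.

(** * Optimal weights and characteristic time in terms of [y] *)

Definition gap2 {R : realType} {K : nat} (mu : 'rV[R]_K) (s a : 'I_K) : R :=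
  (mu 0 s - mu 0 a) ^+ 2.

Definition equalizer {R : realType} {K : nat} (mu : 'rV[R]_K) (s : 'I_K)
    (y : R) : Prop :=
  [/\ 0 < y, forall a, a != s -> 2 * y <= gap2 mu s a &
    \sum_(a | a != s) (y / (gap2 mu s a - y)) ^+ 2 = 1].

Section Optimum.
Context {R : realType} {K : nat}.
Context (mu : 'rV[R]_K) (s : 'I_K) (y : R)
  (Gmu : Gstar mu) (mus : best_arm mu = Some s)
  (ys : exists a, a != s) (eqy : equalizer mu s y).

Implicit Types (v : 'rV[R]_K) (a : 'I_K).

Let D := gap2 mu s.
Let X := \sum_(a | a != s) y / (D a - y).
(** Normalisation: the weights [w] sum to [c / y * (1 + X)]. *)
Let c := y / (1 + X).
Let w : 'rV[R]_K := \row_a if a == s then c / y else c / (D a - y).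

Let y_gt0 : 0 < y. Proof. by case: eqy. Qed.

Let Dy_gt0 a : a != s -> 0 < D a - y.
Proof. by case: eqy => y0 yD _ /yD; rewrite -/(D a) => ?; lra. Qed.

Let X_ge0 : 0 <= X.
Proof. by apply: sumr_ge0 => a /Dy_gt0/ltW ?; rewrite divr_ge0// ltW. Qed.

Let c_gt0 : 0 < c.
Proof. by rewrite divr_gt0// ltr_pwDl. Qed.

Let ws : w 0 s = c / y. Proof. by rewrite mxE eqxx. Qed.

Let wa a : a != s -> w 0 a = c / (D a - y).
Proof. by move=> /negbTE as_; rewrite mxE as_. Qed.

Let w_ge0 a : 0 <= w 0 a.
Proof.
have [->|as_] := eqVneq a s; first by rewrite ws ltW// divr_gt0.
by rewrite wa// ltW// divr_gt0// Dy_gt0.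
Qed.

Let simplex_ge0 v : (forall a, 0 <= v 0 a) -> \sum_a v 0 a = 1 -> simplex v.
Proof.
move=> v0 v1; split => // a; rewrite v0/= -v1 (bigD1 a)//= lerDl.
exact: sumr_ge0.
Qed.

Let w_simplex : simplex w.
Proof.
apply: simplex_ge0 => //; rewrite (bigD1 s)//= ws.
rewrite (eq_bigr (fun a => c / y * (y / (D a - y)))); last first.
  move=> a as_; rewrite wa//; have := Dy_gt0 a as_; move: y_gt0 => y0 Dy.
  by field; rewrite !gt_eqF.
rewrite -mulr_sumr -/X -{1}[c / y]mulr1 -mulrDr /c.
by have := y_gt0; have := X_ge0 => X0 y0; field; rewrite !gt_eqF//; lra.
Qed.

(* Weighting arm [a] by [D a / (D a - y) ^+ 2] turns the arm-wise costs into
   an upper bound that does not depend on [v]; the defect of each arm is the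
   remaining square. *)
Let certificate v e : simplex v ->
  (forall a, a != s -> e <= v 0 s * v 0 a / (v 0 s + v 0 a) * D a) ->
  e / c + \sum_(a | a != s)
    (v 0 s * y - v 0 a * (D a - y)) ^+ 2 / (v 0 s + v 0 a)
      / (D a - y) ^+ 2 <= 1.
Proof.
move=> sv He.
(* In [(1 + X) / y], the 1 is replaced by the sum of squares from the equation for [y]. *)
have -> : c^-1 = \sum_(a | a != s) D a / (D a - y) ^+ 2.
  have [_ _ y1] := eqy.
  rewrite /c invf_div -{1}y1 -/D -big_split/= mulr_suml.
  apply: eq_bigr => a as_.
  by have := Dy_gt0 a as_; move: y_gt0 => y0 Dy; field; rewrite !gt_eqF.
rewrite mulr_sumr -big_split/=.
have [_ _ y1] := eqy.
(* The same equation spreads the weight [v 0 s] over the other arms. *)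
have -> : 1 = \sum_(a | a != s) (v 0 s * (y / (D a - y)) ^+ 2 + v 0 a).
  by rewrite big_split/= -mulr_sumr y1 mulr1 -sv.2 (bigD1 s).
apply: ler_sum => a as_; have Dy := Dy_gt0 a as_.
have /andP[vs0 _] := sv.1 s; have /andP[va0 _] := sv.1 a.
have D0 : 0 < D a by have := y_gt0; lra.
have HD := He a as_.
rewrite mulrA -mulrDl ler_pdivrMr ?exprn_gt0//.
have -> : (v 0 s * (y / (D a - y)) ^+ 2 + v 0 a) * (D a - y) ^+ 2
    = v 0 s * y ^+ 2 + v 0 a * (D a - y) ^+ 2 by field; rewrite gt_eqF.
rewrite (weighted_squares_split _ _ _ _ _ vs0 va0) lerD2r.
have -> : y + (D a - y) = D a by ring.
by rewrite expr2 mulrA ler_pM2r.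
Qed.

Let inf_cost_arm v a : simplex v -> a != s ->
  2 * inf_cost mu v <= v 0 s * v 0 a / (v 0 s + v 0 a) * D a.
Proof.
move=> sv as_; have := inf_cost_le mu v s a sv Gmu mus as_.
by rewrite -/(gap2 mu s a) -/(D a) ler_pdivlMr// mulrC.
Qed.

Let inf_cost_ub v : simplex v -> inf_cost mu v <= c / 2.
Proof.
move=> sv; have := certificate v _ sv (fun a => inf_cost_arm v a sv).
move=> H; have : 2 * inf_cost mu v / c <= 1.
  apply: le_trans H; rewrite lerDl; apply: sumr_ge0 => a as_.
  have /andP[vs0 _] := sv.1 s; have /andP[va0 _] := sv.1 a.
  by rewrite !divr_ge0 ?sqr_ge0 ?addr_ge0.
by rewrite ler_pdivrMr// mul1r => ?; lra.
Qed.

Let inf_cost_w : inf_cost mu w = c / 2.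
Proof.
apply/eqP; rewrite eq_le inf_cost_ub//=.
apply: (inf_cost_ge _ _ s _ w_simplex Gmu mus ys) => a as_.
rewrite -/(gap2 mu s a) -/(D a) ler_pM2r ?invr_gt0// ws wa//.
rewrite le_eqVlt; apply/orP; left; apply/eqP.
have := equalized_weights_cost _ c y _ c_gt0 y_gt0 (Dy_gt0 a as_).
by rewrite subrKC.
Qed.

(** Equality in [certificate] forces every defect to vanish, so [v 0 s * y = v 0 a * (D a - y)]; the
    total weight 1 then fixes [v 0 s]. *)
Let w_unique v : simplex v -> inf_cost mu v = c / 2 -> v = w.
Proof.
move=> sv vc.
have vE a : a != s -> v 0 a = v 0 s * (y / (D a - y)).
  have c_le b : b != s -> c <= v 0 s * v 0 b / (v 0 s + v 0 b) * D b.
    move=> bs; apply: le_trans (inf_cost_arm v b sv bs).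
    by rewrite vc [2 * _]mulrC divfK// pnatr_eq0.
  have := certificate v c sv c_le; rewrite (divff (lt0r_neq0 c_gt0)) gerDl => H.
  have slack_ge0 b : b != s ->
      0 <= (v 0 s * y - v 0 b * (D b - y)) ^+ 2 / (v 0 s + v 0 b)
             / (D b - y) ^+ 2.
    move=> _; have /andP[vs0 _] := sv.1 s; have /andP[vb0 _] := sv.1 b.
    by rewrite !divr_ge0 ?sqr_ge0 ?addr_ge0.
  move=> as_.
  have /psumr_eq0P : \sum_(a | a != s)
      (v 0 s * y - v 0 a * (D a - y)) ^+ 2 / (v 0 s + v 0 a)
        / (D a - y) ^+ 2 = 0.
    apply/eqP; rewrite eq_le sumr_ge0// andbT; exact: H.
  move=> /(_ slack_ge0 a as_)/eqP.
  have := Dy_gt0 a as_ => Dy.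
  have /andP[vs0 _] := sv.1 s; have /andP[va0 _] := sv.1 a.
  rewrite mulf_eq0 invr_eq0 expf_eq0/= (gt_eqF Dy) orbF mulf_eq0 invr_eq0.
  (* The second case is the zero denominator [v 0 s + v 0 a], where both weights are zero. *)
  rewrite expf_eq0/= => /orP[/eqP H0|/eqP H0].
    by apply: (mulIf (lt0r_neq0 Dy)); rewrite mulrA divfK ?lt0r_neq0//; lra.
  have -> : v 0 s = 0 by lra.
  have -> : v 0 a = 0 by lra.
  by rewrite mul0r.
have vs : v 0 s = c / y.
  have := sv.2; rewrite (bigD1 s)//= (eq_bigr _ vE) -mulr_sumr -/X.
  rewrite -{1}[v 0 s]mulr1 -mulrDr => v1; have := y_gt0; have := X_ge0 => X0 y0.
  by rewrite /c mulrAC divff ?gt_eqF// mul1r; apply: (mulIf (x := 1 + X));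
    rewrite ?v1 ?mulVf// gt_eqF//; lra.
apply/rowP => a; have [->|as_] := eqVneq a s; first by rewrite vs ws.
rewrite vE// vs wa//; have := Dy_gt0 a as_; have := y_gt0 => y0 Dy.
by field; rewrite !gt_eqF.
Qed.

Let opt_weightE : opt_weight mu = w.
Proof.
apply: xget_unique.
  by split => // u su; rewrite inf_cost_w inf_cost_ub.
move=> v [sv vmax]; apply: w_unique => //; apply/eqP.
by rewrite eq_le inf_cost_ub// -inf_cost_w vmax.
Qed.

Let char_timeE : char_time mu = 2 / c.
Proof.
rewrite /char_time -[2 / c]invf_div; congr (_^-1); apply/eqP.
rewrite eq_le; apply/andP; split.
  apply: ge_sup; first by exists (inf_cost mu w); exists w.
  by move=> _ [v sv <-]; exact: inf_cost_ub.
rewrite -inf_cost_w; apply: ub_le_sup; last by exists w.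
by exists (c / 2) => _ [v sv <-]; exact: inf_cost_ub.
Qed.

Lemma equalizer_optimum : exists c0, [/\ 0 < c0, char_time mu = 2 / c0,
  simplex (opt_weight mu), inf_cost mu (opt_weight mu) = c0 / 2 &
  (forall v, simplex v -> inf_cost mu v <= c0 / 2)
  /\ opt_weight mu 0 s * y = c0
  /\ forall a, a != s -> opt_weight mu 0 a * (gap2 mu s a - y) = c0].
Proof.
exists c; rewrite opt_weightE; split => //.
split=> //; split=> [|a as_]; first by rewrite ws divfK// gt_eqF.
by rewrite wa// divfK// gt_eqF// Dy_gt0.
Qed.

End Optimum.

(** * Monotonicity and homogeneity in the squared gaps *)

Section Comparison.
Context {R : realType} {K : nat}.
Context (mu mu' : 'rV[R]_K) (s : 'I_K) (k : R).
Context (ys : exists a, a != s) (k_gt0 : 0 < k)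
  (gap2_le : forall a, a != s -> gap2 mu' s a <= k * gap2 mu s a).

Lemma inf_cost_scale_le v : simplex v -> Gstar mu -> Gstar mu' ->
  best_arm mu = Some s -> best_arm mu' = Some s ->
  inf_cost mu' v <= k * inf_cost mu v.
Proof.
move=> sv Gmu Gmu' mus mus'; rewrite -ler_pdivrMl//.
apply: (inf_cost_ge _ _ _ _ sv Gmu mus ys) => a as_.
rewrite ler_pdivrMl//; apply: le_trans (inf_cost_le _ _ _ _ sv Gmu' mus' as_) _.
have /andP[vs0 _] := sv.1 s; have /andP[va0 _] := sv.1 a.
rewrite -/(gap2 mu' s a) -/(gap2 mu s a) [leRHS]mulrA.
rewrite ler_pM2r ?invr_gt0// [leRHS]mulrCA.
by rewrite ler_wpM2l ?gap2_le// divr_ge0 ?mulr_ge0 ?addr_ge0.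
Qed.

(** If [y' > k * y], every ratio [y' / (d' - y')] exceeds [y / (d - y)], so the two sums of squares
    cannot both be 1. *)
Lemma equalizer_scale_le y y' :
  equalizer mu s y -> equalizer mu' s y' -> y' <= k * y.
Proof.
move=> [y0 yD y1] [y'0 yD' y'1]; rewrite leNgt; apply/negP => ky.
have : \sum_(a | a != s) (y / (gap2 mu s a - y)) ^+ 2 <
       \sum_(a | a != s) (y' / (gap2 mu' s a - y')) ^+ 2.
  apply: ltr_sum.
    by have [a as_] := ys; apply/hasP; exists a; rewrite ?mem_index_enum.
  move=> a as_; have := yD a as_; have := yD' a as_; have := gap2_le a as_.
  move: (gap2 mu s a) (gap2 mu' s a) => d d' dd' yd' yd.
  have dy : 0 < d - y by lra.
  have dy' : 0 < d' - y' by lra.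
  rewrite ltr_pXn2r ?nnegrE ?divr_ge0 ?ltW//.
  by rewrite ltr_pdivrMr// mulrAC ltr_pdivlMr//; nra.
by rewrite y1 y'1 ltxx.
Qed.

End Comparison.

(** * Existence of [y] and the explicit constants *)

Lemma equalizer_exists (R : realType) (K : nat) (mu : 'rV[R]_K) (s : 'I_K) :
  Gstar mu -> best_arm mu = Some s -> (exists a, a != s) ->
  exists y, equalizer mu s y.
Proof.
move=> Gmu mus ys.
have [|y [y0 yD y1]] :=
  exists_unit_square_sum _ _ (fun a => a != s) (gap2 mu s) ys.
  by move=> a as_; rewrite exprn_gt0// subr_gt0; exact: best_arm_lt.
by exists y; split.
Qed.

(** Serves for all weights: [z] is [y] for the optimal arm and the squared gap minus [y] for the
    others. *)
Lemma ratio_bounds (R : realFieldType) (eps w w' z z' c c' : R) :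
  0 <= eps <= 1 / 7 -> 0 < z -> 0 < z' -> 0 < c -> 0 < c' ->
  w * z = c -> w' * z' = c' ->
  (1 - eps) * c <= c' <= (1 + eps) * c ->
  (1 - eps ^+ 2) * z <= (1 + 3 * eps) * z' -> z' <= (1 + 3 * eps) * z ->
  (1 - 10 * eps) * w <= w' <= (1 + 10 * eps) * w.
Proof.
move=> /andP[e0 e7] z0 z'0 c0 c'0 wz w'z' /andP[cl cu] zl zu.
have w0 : 0 < w by rewrite -(pmulr_lgt0 _ z0) wz.
apply/andP; split.
  rewrite -(ler_pM2r z'0) w'z'; apply: le_trans cl; rewrite -wz.
  (* [eps] may exceed 1/10, and then the lower bound is trivial. *)
  have [e10|e10] := leP (1 - 10 * eps) 0.
    apply: (@le_trans _ _ 0); last by rewrite !mulr_ge0; lra.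
    by rewrite pmulr_lle0// pmulr_lle0.
  have -> : (1 - eps) * (w * z) = w * ((1 - eps) * z) by ring.
  rewrite mulrAC mulrC ler_pM2l//.
  apply: (@le_trans _ _ ((1 - 10 * eps) * ((1 + 3 * eps) * z))).
    by rewrite ler_pM2l.
  by rewrite mulrA ler_pM2r//; nra.
have zl' : (1 - eps) * z * (1 + eps) <= (1 + 3 * eps) * z'.
  by apply: le_trans zl; nra.
rewrite -(ler_pM2r z'0) w'z'; apply: le_trans cu _; rewrite -wz.
have -> : (1 + eps) * (w * z) = w * ((1 + eps) * z) by ring.
rewrite [leRHS]mulrAC [leRHS]mulrC ler_pM2l//.
have e1 : 0 < 1 - eps by lra.
rewrite -(ler_pM2l e1); apply: (@le_trans _ _ ((1 + 3 * eps) * z')).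
  by apply: le_trans zl'; nra.
by rewrite mulrA ler_pM2r//; nra.
Qed.

Theorem theorem14 (R : realType) (K : nat) (mu mu' : 'rV[R]_K) (astar : 'I_K)
    (eps : R) :
  (2 <= K)%N ->
  Gstar mu -> Gstar mu' ->
  best_arm mu = Some astar -> best_arm mu' = Some astar ->
  0 <= eps <= 1 / 7 ->
  (forall a : 'I_K, a != astar ->
     (1 - eps) * (mu 0 astar - mu 0 a) ^+ 2
       <= (mu' 0 astar - mu' 0 a) ^+ 2
       <= (1 + eps) * (mu 0 astar - mu 0 a) ^+ 2) ->
  (1 - 3 * eps) * char_time mu <= char_time mu'
    <= (1 + 6 * eps) * char_time mu /\
  (forall a : 'I_K,
     (1 - 10 * eps) * opt_weight mu 0 a <= opt_weight mu' 0 a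
       <= (1 + 10 * eps) * opt_weight mu 0 a).
Proof.
move=> K2 Gmu Gmu' mus mus' eps_bnd HD.
have /andP[e0 e7] := eps_bnd.
have ys : exists a, a != astar.
  have /card_gt0P[a] : (0 < #|[pred a | a != astar]|)%N.
    by rewrite (cardC1 astar) card_ord -ltnS prednK// (leq_trans _ K2).
  by exists a.
have [y eqy] := equalizer_exists _ _ mu astar Gmu mus ys.
have [y' eqy'] := equalizer_exists _ _ mu' astar Gmu' mus' ys.
have [c [c0 -> sw wc [cmax [cs ca]]]] := equalizer_optimum _ _ _ Gmu mus ys eqy.
have [c' [c'0 -> sw' wc' [cmax' [cs' ca']]]] :=
  equalizer_optimum _ _ _ Gmu' mus' ys eqy'.
have [y0 yD _] := eqy; have [y'0 yD' _] := eqy'.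
have ku : 0 < 1 + eps by lra.
have kl : 0 < 1 - eps by lra.
have kli : 0 < (1 - eps)^-1 by rewrite invr_gt0.
have gu a : a != astar -> gap2 mu' astar a <= (1 + eps) * gap2 mu astar a.
  by move=> /HD/andP[].
have gl a : a != astar -> gap2 mu astar a <= (1 - eps)^-1 * gap2 mu' astar a.
  by move=> /HD/andP[+ _]; rewrite ler_pdivlMl.
have cu : c' <= (1 + eps) * c.
  (* The costs are compared at the optimal weights for [mu'], which need not be optimal for [mu]. *)
  have := inf_cost_scale_le mu mu' _ _ ys ku gu _ sw' Gmu Gmu' mus mus'.
  by rewrite wc'; have := cmax _ sw'; nra.
have cl : (1 - eps) * c <= c'.
  have := inf_cost_scale_le mu' mu _ _ ys kli gl _ sw Gmu' Gmu mus' mus.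
  by rewrite ler_pdivlMl// wc; have := cmax' _ sw; lra.
have yu := equalizer_scale_le mu mu' _ _ ys gu _ _ eqy eqy'.
have yl : (1 - eps) * y <= y'.
  by rewrite -ler_pdivlMl//;
  exact: equalizer_scale_le mu' mu _ _ ys gl _ _ eqy' eqy.
split=> [|a].
  (* With T = 2 / c, this rests on [(1 - 3 * eps) * (1 + eps) <= 1 <= (1 + 6 * eps) * (1 - eps)]. *)
  apply/andP; split; rewrite mulrA ler_pdivrMr// mulrAC ler_pdivlMr//; nra.
have [->|as_] := eqVneq a astar.
  by apply: (ratio_bounds _ _ _ _ _ _ _ _ eps_bnd y0 y'0 c0 c'0) => //;
    rewrite ?cl ?cu//; nra.
have /andP[HDl HDu] := HD a as_.
have := ca a as_; have := ca' a as_; have := yD a as_; have := yD' a as_.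
rewrite /gap2; move: HDl HDu.
move: ((mu 0 astar - _) ^+ 2) ((mu' 0 astar - _) ^+ 2) => d d'.
move=> HDl HDu yd' yd ca1' ca1.
(* Here [d' - y' <= (1 + eps) * (d - y) + 2 * eps * y], and [y <= d - y] gives the factor
   [1 + 3 * eps]; the other bound exchanges the roles after multiplying by [1 - eps ^+ 2]. *)
by apply: (ratio_bounds _ _ _ _ _ _ _ _ eps_bnd _ _ c0 c'0 ca1 ca1');
  rewrite ?cl ?cu//; nra.
Qed.
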